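(* There exist arbitrarily large families of convex bodies in the plane such that any two members have precisely six common supporting tangents, any four members are in convex position, and no five members are in convex position.
   Context: A convex body is a (nonempty) compact convex subset of $\mathbb{R}^2$. A family of sets is in convex position if no member is contained in the convex hull of the (union of the) other members. For a convex body $K$ let $g_K(\theta)=\max_{p\in K}\langle\theta,p\rangle$, $\theta\in\mathbb{S}^1$, be its support function. A common supporting tangent of two convex bodies $K,L$ is a line supporting both $K$ and $L$ with both bodies on the same side; these are counted as the directions $\theta\in\mathbb{S}^1$ with $g_K(\theta)=g_L(\theta)$. ''Arbitrarily large'' means: for every $N$ there is such a family with at least $N$ members. *)

(* Defs.v *)
From HB Require Import structures.
From mathcomp Require Import all_boot all_order all_algebra.
From mathcomp Require Import all_classical all_reals all_analysis.
Import Order.TTheory GRing.Theory Num.Theory.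
Import numFieldNormedType.Exports.

Set Implicit Arguments.
Unset Strict Implicit.
Unset Printing Implicit Defensive.

Local Open Scope classical_set_scope.
Local Open Scope ring_scope.

Definition dotprod (R : realType) (u v : 'rV[R]_2) : R :=
  \sum_(i < 2) u ord0 i * v ord0 i.

(* The library norm on row vectors is the sup norm, so the Euclidean unit
   circle is defined through the inner product. *)
Definition unit_circle (R : realType) : set 'rV[R]_2 :=
  [set theta | dotprod theta theta = 1].

Definition convex_body (R : realType) (K : set 'rV[R]_2) : Prop :=
  [/\ K !=set0, compact K & convex_set K].

(* The supremum is a maximum when K is nonempty and compact. *)
Definition support_function (R : realType) (K : set 'rV[R]_2)
    (theta : 'rV[R]_2) : R :=
  sup [set dotprod theta p | p in K].

Definition common_supporting_tangents (R : realType) (K L : set 'rV[R]_2) :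
    set 'rV[R]_2 :=
  [set theta | unit_circle theta /\
               support_function K theta = support_function L theta].

Definition convex_hull (R : realType) (A : set 'rV[R]_2) : set 'rV[R]_2 :=
  smallest (@convex_set R 'rV[R]_2) A.

Definition in_convex_position (R : realType) (F : set (set 'rV[R]_2)) : Prop :=
  forall K, F K -> ~ (K `<=` convex_hull (\bigcup_(L in F `\ K) L)).

(* Main.v *)
Require Import Defs.
From HB Require Import structures.
From mathcomp Require Import all_boot all_order all_algebra.
From mathcomp Require Import all_classical all_reals all_analysis.
From mathcomp Require Import zify ring lra.
Import Order.TTheory GRing.Theory Num.Theory.
Import numFieldNormedType.Exports.
Local Open Scope classical_set_scope.
Local Open Scope ring_scope.

Set Implicit Arguments.
Unset Strict Implicit.
Unset Printing Implicit Defensive.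

(** Let [w = N] and [C = w (N + 1)^2]. The body of index [i], [1 <= i <= N], is the
convex hull of the points [(±(C - w k^2) - i, k)] with [0 <= k <= N + 1] and [k <> i]:
a polygon inscribed in two opposite parabolic arcs, with the two vertices at height [i]
cut off, translated by [-i] along the first axis. In the direction [(±1, t)] its support
function is [C ∓ i + E(t) - dip_i(t)], where [E] does not depend on [i] and the tent
[dip_i], of height [w], lives on the interval of center [2 w i] and radius [w]. These
intervals do not overlap, so for [i < j] the support functions agree exactly twice on
the right side (inside the tent of [i]), twice on the left side (inside the tent of
[j]), and at [(0, ±1)].

On the right side the smallest index of a subfamily is on top, except in the middle of
its own tent, where the second smallest one is; on the left side the same holds for the
two largest indices. So any four bodies are in convex position. If [c] has two smaller
and two larger indices in the subfamily, every vertex of the body [c] lies on a horizontal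
segment between a body of smaller and a body of larger index that both keep this
vertex, so body [c] is in the hull of the others. *)

(** * Convex hulls of finite families of points *)

Section Polytope.
Variables (R : realType) (V : normedModType R) (I : finType).
Implicit Types (v : I -> V) (l : I -> R).

Definition simplex : set (I -> R) :=
  [set l | (forall i, 0 <= l i) /\ \sum_i l i = 1].

Definition polytope v : set V :=
  [set \sum_i l i *: v i | l in simplex].

Lemma polytope_vertex v i : polytope v (v i).
Proof.
exists (fun j => (j == i)%:R).
  split=> [j|]; first by rewrite ler0n.
  by rewrite (bigD1 i)//= eqxx big1 ?addr0// => j /negPf ->.
rewrite (bigD1 i)//= eqxx scale1r big1 ?addr0// => j /negPf ->.
by rewrite scale0r.
Qed.

Lemma convex_polytope v : convex_set (polytope v).
Proof.
move=> _ _ t /set_mem[l [l0 l1] <-] /set_mem[m [m0 m1] <-]; apply/mem_set.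
exists (fun i => t%:num * l i + (1 - t%:num) * m i).
  split=> [i|]; first by rewrite addr_ge0// mulr_ge0// ?subr_ge0.
  by rewrite big_split/= -!mulr_sumr l1 m1 !mulr1 addrC subrK.
rewrite /conv/= !scaler_sumr -big_split/=; apply: eq_bigr => i _.
by rewrite scalerDl !scalerA.
Qed.

Lemma continuous_sum (T : topologicalType) (W : normedModType R)
    (s : seq I) (f : I -> T -> W) :
  (forall i, continuous (f i)) -> continuous (fun x => \sum_(i <- s) f i x).
Proof.
move=> fc; elim: s => [|i s IH] x.
  under eq_fun do rewrite big_nil.
  exact: cst_continuous.
under eq_fun do rewrite big_cons.
by apply: continuousD; [exact: fc | exact: IH].
Qed.

Let coord_continuous (i : I) :
  continuous (fun l : prod_topology (fun _ : I => R) => l i).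
Proof. exact: proj_continuous. Qed.

(** The simplex is closed in the cube of functions with values in [0, 1], which is compact by
    Tychonoff's theorem. A polytope is then compact as its continuous image. *)
Lemma compact_simplex :
  compact (simplex : set (prod_topology (fun _ : I => R))).
Proof.
apply: (@subclosed_compact _ _
    [set l : prod_topology (fun _ : I => R) | forall i, `[0, 1]%classic (l i)]).
- have -> : simplex = \bigcap_i [set l : I -> R | 0 <= l i] `&`
      [set l | \sum_i l i = 1].
    by apply/seteqP; split=> l [l0 l1]; split=> // i; [move=> _|]; exact: l0.
  apply: closedI.
    apply: closed_bigI => i _.
    have /continuous_closedP/(_ _ (@closed_ge _ (0 : R))) := @coord_continuous i.
    exact.
  have /continuous_closedP := @continuous_sum _ R^o (index_enum I) _ coord_continuous.
  by move=> /(_ _ (@closed_eq _ (1 : R))); exact.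
- exact: (@tychonoff I (fun=> R) _ (fun=> @segment_compact _ 0 1)).
- move=> l [l0 l1] i /=; rewrite in_itv/= l0 -l1 (bigD1 i)//=.
  by rewrite lerDl sumr_ge0.
Qed.

Lemma compact_polytope v : compact (polytope v).
Proof.
apply: continuous_compact compact_simplex.
apply: continuous_subspaceT; apply: continuous_sum => i l.
by apply: continuousZr_tmp; exact: coord_continuous.
Qed.

End Polytope.

Lemma convex_setP (R : realType) (M : lmodType R) (A : set M) :
  @convex_set R M A <-> forall (x y : M) (t : R), 0 <= t -> t <= 1 -> A x -> A y ->
    A (t *: x + (1 - t) *: y).
Proof.
split=> [cA x y t t0 t1 Ax Ay | cA x y t /set_mem Ax /set_mem Ay].
  by have := cA x y (Itv01 t0 t1) (mem_set Ax) (mem_set Ay) => /set_mem.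
by apply/mem_set; apply: cA.
Qed.

(** Induction along the list of indices: each partial sum is its total weight times some point [c]
    of [C]. If that weight vanishes, any point of [C] will do. *)
Lemma polytope_sub (R : realType) (V : normedModType R) (I : finType)
    (v : I -> V) (C : set V) :
  @convex_set R V C -> (forall i, C (v i)) -> polytope v `<=` C.
Proof.
move=> /convex_setP cC Cv _ [l [l0 l1] <-].
have [i0 _|I0] := pickP (@predT I); last first.
  by move: l1; rewrite big_pred0// => /eqP; rewrite eq_sym oner_eq0.
suff [c Cc ->] : exists2 c, C c & \sum_i l i *: v i = (\sum_i l i) *: c.
  by rewrite l1 scale1r.
elim: (index_enum I) => [|i s [c Cc IH]].
  by exists (v i0); rewrite // !big_nil scale0r.
rewrite !big_cons IH; set T := \sum_(_ <- _) _.
have T0 : 0 <= T by exact: sumr_ge0.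
have [lT|lT] := eqVneq (l i + T) 0.
  exists c; rewrite // lT scale0r; move/eqP: lT.
  by rewrite paddr_eq0// => /andP[/eqP-> /eqP->]; rewrite !scale0r addr0.
have lT0 : 0 < l i + T by rewrite lt_def lT addr_ge0.
exists ((l i / (l i + T)) *: v i + (1 - l i / (l i + T)) *: c).
  apply: cC => //; first by rewrite divr_ge0// ltW.
  by rewrite ler_pdivrMr// mul1r lerDl.
rewrite scalerDr !scalerA mulrBr mulr1 mulrC divfK// (addrC (l i)) addrK.
by [].
Qed.

(** * Half-planes and support functions of polygons *)

Section Plane.
Variable R : realType.
Implicit Types (theta p : 'rV[R]_2) (K : set 'rV[R]_2).

Definition vec2 (x y : R) : 'rV[R]_2 :=
  \row_(j < 2) if j == ord0 then x else y.

Lemma dotprodE theta p :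
  dotprod theta p = theta ord0 ord0 * p ord0 ord0 + theta ord0 ord_max * p ord0 ord_max.
Proof. by rewrite /dotprod big_ord_recl big_ord1; congr (_ + _ * _); congr (_ _ _); apply/val_inj. Qed.

Lemma vec2K theta : vec2 (theta ord0 ord0) (theta ord0 ord_max) = theta.
Proof.
apply/rowP => j; rewrite mxE; case: ifPn => [/eqP->//|j0].
by congr (theta _ _); apply/val_inj; case: j j0 => -[|[|]].
Qed.

Lemma dotprod_vec2 a b x y : dotprod (vec2 a b) (vec2 x y) = a * x + b * y.
Proof. by rewrite dotprodE !mxE. Qed.

Lemma dotprod_conv theta p q (t : R) :
  dotprod theta (t *: p + (1 - t) *: q) =
  t * dotprod theta p + (1 - t) * dotprod theta q.
Proof. by rewrite !dotprodE !mxE; ring. Qed.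

Lemma convex_halfplane theta (m : R) :
  convex_set [set p | dotprod theta p <= m].
Proof.
apply/convex_setP => p q t t0 t1 /= pm qm; rewrite dotprod_conv.
have : 0 <= t * (m - dotprod theta p) by rewrite mulr_ge0 ?subr_ge0.
have : 0 <= (1 - t) * (m - dotprod theta q) by rewrite mulr_ge0 ?subr_ge0.
lra.
Qed.

Lemma convex_open_halfplane theta (m : R) :
  convex_set [set p | dotprod theta p < m].
Proof.
apply/convex_setP => p q t t0 t1 /= pm qm; rewrite dotprod_conv.
have [->|tN0] := eqVneq t 0; first by lra.
have : 0 < t * (m - dotprod theta p) by rewrite mulr_gt0 ?subr_gt0// lt_def tN0.
have : 0 <= (1 - t) * (m - dotprod theta q) by rewrite mulr_ge0 ?subr_ge0// ltW.
lra.
Qed.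

Lemma support_function_polytope (I : finType) (v : I -> 'rV[R]_2) theta (m : R) :
  (forall i, dotprod theta (v i) <= m) ->
  (exists i, dotprod theta (v i) = m) ->
  support_function (polytope v) theta = m.
Proof.
move=> vm [i vi].
have ubm : ubound [set dotprod theta p | p in polytope v] m.
  by move=> _ [p /(polytope_sub (@convex_halfplane theta m) vm) /= ? <-].
apply/eqP; rewrite eq_le; apply/andP; split.
  by apply: ge_sup => //; exists (dotprod theta (v i)); exists (v i) => //;
    exact: polytope_vertex.
by apply: ub_le_sup; [exists m | exists (v i) => //; exact: polytope_vertex].
Qed.

Lemma convex_body_polytope (I : finType) (v : I -> 'rV[R]_2) (i : I) :
  convex_body (polytope v).
Proof.
split; [|exact: compact_polytope|exact: convex_polytope].
by exists (v i); exact: polytope_vertex.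
Qed.

End Plane.

(** * The bodies and their support functions *)

Section Bodies.
Variables (R : realType) (N : nat).
Implicit Types (i j k : nat) (a b : bool) (c t x : R).

Local Notation w := (N%:R : R).
Local Notation C := (w * N.+1%:R ^+ 2 : R).

(** [b] selects the right ([false]) or the left ([true]) arc, and [x] is the amount of the
    translation to the left. The two arcs meet at [k = N.+1]. *)
Definition site b k x : 'rV[R]_2 :=
  vec2 ((-1) ^+ b * (C - w * k%:R ^+ 2) - x) k%:R.

(* The site [k = i] is deleted from the body [i] by merging it with the site [k = 0]. *)
Definition body i : set 'rV[R]_2 :=
  polytope (fun u : bool * 'I_N.+2 =>
    site u.1 (if u.2 == i :> nat then 0 else u.2)%N i%:R).

Lemma body_site i b k : (k <= N.+1)%N -> k <> i -> body i (site b k i%:R).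
Proof.
move=> kN ki; have := polytope_vertex (fun u : bool * 'I_N.+2 =>
    site u.1 (if u.2 == i :> nat then 0 else u.2)%N i%:R) (b, inord k).
by rewrite /= inordK//; case: eqP.
Qed.

Lemma body_sub i (A : set 'rV[R]_2) : (0 < i)%N -> @convex_set R 'rV[R]_2 A ->
  (forall b k, (k <= N.+1)%N -> k <> i -> A (site b k i%:R)) -> body i `<=` A.
Proof.
move=> i0 cA Asite; apply: polytope_sub => // -[b k] /=.
(* The substitute site 0 has not itself been deleted, because [0 < i]. *)
by case: eqP => [_|ki]; apply: Asite => //; [lia|rewrite -ltnS].
Qed.

Lemma support_body i theta (m : R) : (0 < i)%N ->
  (forall b k, (k <= N.+1)%N -> k <> i -> dotprod theta (site b k i%:R) <= m) ->
  (exists b k, [/\ (k <= N.+1)%N, k <> i & dotprod theta (site b k i%:R) = m]) ->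
  support_function (body i) theta = m.
Proof.
move=> i0 lem [b [k [kN ki ekm]]]; apply: support_function_polytope => [[b' k']|].
  by case: eqP => [_|ki']; apply: lem => //=; [lia|rewrite -ltnS].
by exists (b, inord k); rewrite /= inordK//; case: eqP.
Qed.

Lemma convex_body_body i : convex_body (body i).
Proof. exact: (convex_body_polytope _ (true, ord0)). Qed.

(** In the direction (±1, t), this is what the height [k] contributes on the arc of that side, up to
    [C] and the translation. The lines [tooth k] have slopes [k], and neighbours [k] and [k + 1]
    cross at [w (2 k + 1)]; [envelope] is the discrete Legendre transform of [w k^2]. *)
Definition tooth k t : R := t * k%:R - w * k%:R ^+ 2.

Definition envelope t : R := \big[Num.max/0]_(k < N.+2) tooth k t.

(** The amount by which the envelope drops when the line of index [i] is removed: the smaller of its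
    leads over its two neighbours, cut off at 0. *)
Definition dip i t : R :=
  Num.max 0 (Num.min (t - (2 * (w * i%:R) - w)) (2 * (w * i%:R) + w - t)).

Lemma toothB k l t : tooth k t - tooth l t = (k%:R - l%:R) * (t - w * (k + l)%:R).
Proof. by rewrite /tooth natrD; ring. Qed.

Lemma tooth_left k i t : (k < i)%N -> 2 * (w * i%:R) - w <= t ->
  tooth k t <= tooth i.-1 t.
Proof.
case: i => // i; rewrite ltnS => ki lt_t /=.
rewrite -subr_ge0 toothB mulr_ge0// ?subr_ge0 ?ler_nat//.
apply: le_trans lt_t; rewrite natrD -(natr1 i).
have : w * k%:R <= w * i%:R by rewrite ler_wpM2l// ler_nat.
have := ler0n R N; lra.
Qed.

Lemma tooth_right k i t : (i < k)%N -> t <= 2 * (w * i%:R) + w ->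
  tooth k t <= tooth i.+1 t.
Proof.
move=> ik le_t; rewrite -subr_ge0 -opprB toothB -mulrN mulr_ge0// ?subr_ge0 ?ler_nat//.
rewrite oppr_ge0 subr_le0; apply: le_trans le_t _; rewrite natrD -(natr1 i).
have : w * i.+1%:R <= w * k%:R by rewrite ler_wpM2l// ler_nat.
rewrite -(natr1 i); have := ler0n R N; lra.
Qed.

Lemma tooth_pred i t : (0 < i)%N ->
  tooth i t - tooth i.-1 t = t - (2 * (w * i%:R) - w).
Proof. by case: i => // i _; rewrite toothB /= natrD -(natr1 i); ring. Qed.

Lemma tooth_succ i t : tooth i t - tooth i.+1 t = 2 * (w * i%:R) + w - t.
Proof. by rewrite toothB natrD -(natr1 i); ring. Qed.

Lemma tooth_envelope k t : (k <= N.+1)%N -> tooth k t <= envelope t.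
Proof. by move=> kN; exact: (le_bigmax _ _ (Ordinal (kN : (k < N.+2)%N))). Qed.

Lemma envelope_attained t : exists2 k, (k <= N.+1)%N & envelope t = tooth k t.
Proof.
rewrite /envelope; elim/big_ind: _ => [|x y [k kN ->] [l lN ->]|k _].
(* The default value 0 of the maximum is harmless: it is [tooth 0 t]. *)
- by exists 0%N; rewrite // /tooth; ring.
- by case: (leP (tooth k t) (tooth l t)) => _; [exists l|exists k].
- by exists k; rewrite // -ltnS.
Qed.

(** Outside its tent the line [i] is not strictly above both neighbours, so its removal changes
    nothing. Inside, it is the envelope, and the best remaining line is a neighbour. Both neighbours
    exist since [0 < i <= N] and the heights run from 0 to [N + 1]. *)
Lemma envelope_dip i t : (0 < i <= N)%N ->
  (forall k, (k <= N.+1)%N -> k <> i -> tooth k t <= envelope t - dip i t) /\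
  (exists k, [/\ (k <= N.+1)%N, k <> i & tooth k t = envelope t - dip i t]).
Proof.
move=> /andP[i0 iN]; have [k0 k0N ek0] := envelope_attained t.
have iE : tooth i t <= envelope t by apply: tooth_envelope; lia.
have pE : tooth i.-1 t <= envelope t by apply: tooth_envelope; lia.
have sE : tooth i.+1 t <= envelope t by apply: tooth_envelope; lia.
have := tooth_pred t i0; have := tooth_succ i t; rewrite /dip => es ep.
have [tl|tl] := leP t (2 * (w * i%:R) - w).
  have -> : Num.max 0 (Num.min (t - (2 * (w * i%:R) - w)) (2 * (w * i%:R) + w - t)) = 0 :> R.
    by apply/max_idPl; rewrite ge_min; apply/orP; left; lra.
  split=> [k kN _|]; first by rewrite subr0 tooth_envelope.
  (* If the maximum found is at [i] itself, then [i.-1] ties with it, as [t] is not beyond their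
     crossing point. *)
  have [k0i|k0i] := eqVneq k0 i; last by exists k0; split=> //; [exact/eqP|rewrite subr0].
  by exists i.-1; split; [lia|lia|]; move: ek0; rewrite k0i; lra.
have [tr|tr] := leP (2 * (w * i%:R) + w) t.
  have -> : Num.max 0 (Num.min (t - (2 * (w * i%:R) - w)) (2 * (w * i%:R) + w - t)) = 0 :> R.
    by apply/max_idPl; rewrite ge_min; apply/orP; right; lra.
  split=> [k kN _|]; first by rewrite subr0 tooth_envelope.
  have [k0i|k0i] := eqVneq k0 i; last by exists k0; split=> //; [exact/eqP|rewrite subr0].
  by exists i.+1; split; [lia|lia|]; move: ek0; rewrite k0i; lra.
have left k : (k < i)%N -> tooth k t <= tooth i.-1 t.
  by move=> ki; apply: tooth_left => //; lra.
have right k : (i < k)%N -> tooth k t <= tooth i.+1 t.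
  by move=> ki; apply: tooth_right => //; lra.
have Ei : envelope t = tooth i t.
  apply/eqP; rewrite eq_le iE andbT ek0.
  by case: (ltngtP k0 i) => [/left|/right|->//]; lra.
rewrite Ei -es -ep; set m := Num.min _ _.
have [m0 ml mr] : [/\ 0 <= m, tooth i.-1 t <= tooth i t - m & tooth i.+1 t <= tooth i t - m].
  by rewrite /m; case: (leP (_ - tooth i.-1 t)) => ?; split; lra.
have -> : Num.max 0 m = m by apply/max_idPr.
split=> [k kN ki|].
  by case: (ltngtP k i) => [/left|/right|/ki//]; lra.
rewrite /m; case: leP => _.
  by exists i.-1; split; [lia|lia|lra].
by exists i.+1; split; [lia|lia|lra].
Qed.

Lemma dotprod_site a b k i c t :
  dotprod (vec2 ((-1) ^+ a * c) (c * t)) (site b k i%:R) =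
  c * ((-1) ^+ (a (+) b) * (C - w * k%:R ^+ 2) + t * k%:R - (-1) ^+ a * i%:R).
Proof. by rewrite dotprod_vec2; case: a; case: b => /=; ring. Qed.

Lemma height_ge0 k : (k <= N.+1)%N -> 0 <= C - w * k%:R ^+ 2.
Proof.
move=> kN; rewrite -mulrBr mulr_ge0// subr_ge0.
by rewrite ler_pXn2r// ?nnegrE// ler_nat.
Qed.

(** The vertices of the opposite arc never win, because [C] is large enough for all half-widths
    [C - w k^2] to be nonnegative. *)
Lemma dotprod_site_le a b k i c t : 0 <= c -> (k <= N.+1)%N ->
  dotprod (vec2 ((-1) ^+ a * c) (c * t)) (site b k i%:R) <=
  c * (C + tooth k t - (-1) ^+ a * i%:R).
Proof.
move=> c0 kN; rewrite dotprod_site ler_wpM2l// /tooth.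
by have := height_ge0 kN; case: (a (+) b) => /=; lra.
Qed.

Lemma support_body_dir i a c t : (0 < i <= N)%N -> 0 <= c ->
  support_function (body i) (vec2 ((-1) ^+ a * c) (c * t)) =
  c * (C + (envelope t - dip i t) - (-1) ^+ a * i%:R).
Proof.
move=> iN c0; have [lem [k [kN ki ek]]] := envelope_dip t iN.
case/andP: iN => i0 iN.
apply: support_body => // [b l lN li|].
  apply: le_trans (dotprod_site_le a b i t c0 lN) _.
  by rewrite ler_wpM2l//; have := lem l lN li; lra.
exists a, k; split=> //; rewrite dotprod_site addbb -ek /tooth /=; ring.
Qed.

Lemma support_body_up i : (0 < i <= N)%N ->
  support_function (body i) (vec2 0 1) = N.+1%:R.
Proof.
move=> /andP[i0 iN]; apply: support_body => // [b k kN ki|].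
  by rewrite dotprod_vec2 mul0r mul1r add0r ler_nat.
by exists true, N.+1; split; rewrite ?dotprod_vec2 ?mul0r ?mul1r ?add0r//; lia.
Qed.

Lemma support_body_down i : (0 < i <= N)%N ->
  support_function (body i) (vec2 0 (-1)) = 0.
Proof.
move=> /andP[i0 iN]; apply: support_body => // [b k kN ki|].
  by rewrite dotprod_vec2 mul0r add0r mulN1r oppr_le0.
by exists true, 0%N; split; rewrite ?dotprod_vec2 ?mul0r ?mulr0 ?add0r//; lia.
Qed.

(** The centers of two tents are at least [2 w] apart, so where one is positive the other vanishes.
    A positive difference [d] must therefore be the value of the tent of [i], which is taken once on
    each slope. *)
Lemma dip_crossing i j t (d : R) : i <> j -> 0 < d -> d < w ->
  (dip i t - dip j t = d <->
   t = 2 * (w * i%:R) - w + d \/ t = 2 * (w * i%:R) + w - d).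
Proof.
move=> ij d0 dw; have wij : w * i%:R + w <= w * j%:R \/ w * j%:R + w <= w * i%:R.
  have h k l : (k < l)%N -> w * k%:R + w <= w * l%:R.
    by move=> kl; rewrite -{2}(mulr1 w) -mulrDr ler_wpM2l// natr1 ler_nat.
  by case: (ltngtP i j) => [/h|/h|/ij//]; [left|right].
rewrite /dip; move: (w * i%:R) (w * j%:R) wij => p q wij.
set mp := Num.min _ _; set mq := Num.min _ (2 * q + w - t).
have mq0 : 0 < mp -> Num.max 0 mq = 0.
  rewrite /mp lt_min => /andP[tl tr]; apply/max_idPl; rewrite ge_min; apply/orP.
  by case: wij => ?; [left|right]; lra.
split=> [E|tE].
  have mp0 : 0 < mp.
    rewrite ltNge; apply/negP => /max_idPl mp0.
    have : 0 <= Num.max 0 mq by rewrite le_max lexx.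
    by move: E; rewrite mp0; lra.
  move: E; rewrite mq0// subr0 (max_idPr (ltW mp0)) /mp.
  by case: leP => _ <-; [left|right]; lra.
have mpE : mp = d.
  by rewrite /mp; case: leP => ?; case: tE => tE; lra.
by rewrite mq0 mpE// subr0; apply/max_idPr; lra.
Qed.

End Bodies.

(** * The unit circle as two vertical directions and two open half-circles *)

Section Directions.
Variable R : realType.
Implicit Types (a b : bool) (s t x y : R).

(** The vector (±1, t), normalised; [a = true] gives the left half-circle. *)
Definition dir a t : 'rV[R]_2 :=
  vec2 ((-1) ^+ a * (Num.sqrt (1 + t ^+ 2))^-1) ((Num.sqrt (1 + t ^+ 2))^-1 * t).

Lemma inv_sqrt1D_gt0 t : 0 < (Num.sqrt (1 + t ^+ 2))^-1.
Proof. by rewrite invr_gt0 sqrtr_gt0 ltr_wpDr// sqr_ge0. Qed.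

Lemma vec2_inj x y s t : vec2 x y = vec2 s t -> x = s /\ y = t.
Proof.
by move=> /rowP E; split; [have := E ord0 | have := E ord_max]; rewrite !mxE.
Qed.

Lemma unit_dir a t : unit_circle (dir a t).
Proof.
rewrite /unit_circle/= dotprod_vec2.
have -> : forall c : R, (-1) ^+ a * c * ((-1) ^+ a * c) + c * t * (c * t) = c ^+ 2 * (1 + t ^+ 2).
  by move=> c; case: a => /=; ring.
rewrite exprVn sqr_sqrtr ?addr_ge0 ?sqr_ge0// mulVf//.
by rewrite gt_eqF// ltr_wpDr// sqr_ge0.
Qed.

Lemma unit_circle_cases theta : unit_circle theta ->
  [\/ theta = vec2 0 1, theta = vec2 0 (-1) | exists a t, theta = dir a t].
Proof.
rewrite -(vec2K theta); move: (theta ord0 ord0) (theta ord0 ord_max) => x y.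
rewrite /unit_circle/= dotprod_vec2 -!expr2 => xy1.
have [x0|x0] := eqVneq x 0.
  move: xy1; rewrite x0 expr0n add0r => /eqP; rewrite sqrf_eq1.
  by case/orP=> /eqP ->; [constructor 1|constructor 2].
constructor 3; exists (x < 0), (y / `|x|); rewrite /dir.
have -> : 1 + (y / `|x|) ^+ 2 = `|x|^-1 ^+ 2.
  rewrite exprMn exprVn real_normK ?num_real//.
  by rewrite -[1](@divff _ (x ^+ 2)) ?expf_eq0// -mulrDl xy1 mul1r.
rewrite sqrtr_sqr normrV ?unitfE ?normr_eq0// normr_id invrK.
by rewrite -realEsign ?num_real// mulrC divfK ?normr_eq0.
Qed.

Lemma dir_eq a b s t : (dir a s == dir b t) = (a == b) && (s == t).
Proof.
apply/eqP/andP => [/vec2_inj[E1 E2]|[/eqP-> /eqP->]//].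
move: E1 E2 (inv_sqrt1D_gt0 s) (inv_sqrt1D_gt0 t); move: (_^-1) (_^-1) => c d.
by case: a b => -[]; rewrite /= ?expr1 ?expr0 => E1 E2 c0 d0; split=> //; try (exfalso; lra);
  have cd : c = d by [lra]; move: E2; rewrite cd => /mulfI->//; rewrite gt_eqF.
Qed.

Lemma vertical_dir a t y : (vec2 0 y == dir a t) = false.
Proof.
apply/negP => /eqP/vec2_inj[E1 _]; have := inv_sqrt1D_gt0 t; move: E1.
by case: a; rewrite /= ?expr1 ?expr0; lra.
Qed.

Lemma card_eq_uniq (T : eqType) (s : seq T) (x0 : T) : uniq s ->
  ([set` s] #= `I_(size s))%card.
Proof.
move=> us; have -> : [set` s] = nth x0 s @` `I_(size s).
  apply/seteqP; split=> x /=; first by move/(nthP x0) => [i ilt <-]; exists i.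
  by move=> [i ilt <-]; exact: mem_nth.
apply: inj_card_eq => i j /set_mem /= ilt /set_mem /= jlt /eqP.
by rewrite nth_uniq// => /eqP.
Qed.

End Directions.

Lemma convex_convex_hull (R : realType) (A : set 'rV[R]_2) :
  convex_set (convex_hull A).
Proof.
apply/convex_setP => p q t t0 t1 pA qA X [cX AX].
by apply: (convex_setP X).1 => //; [exact: pA|exact: qA].
Qed.

(** * Common tangents and convex position in the family *)

Section Family.
Variables (R : realType) (N : nat).
Implicit Types (i j k l m : nat) (b : bool).

Local Notation w := (N%:R : R).
Local Notation body := (@body R N).
Local Notation site := (@site R N).

Definition bodies : set (set 'rV[R]_2) := (fun i => body i.+1) @` `I_N.

Lemma bodiesP K : bodies K <-> exists2 i, (0 < i <= N)%N & K = body i.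
Proof.
split=> [[i /= iN <-]|[[//|i] iN ->]]; first by exists i.+1.
by exists i.
Qed.

Lemma support_body_eq_dir i j b t : (0 < i <= N)%N -> (0 < j <= N)%N ->
  support_function (body i) (dir b t) = support_function (body j) (dir b t) <->
  dip N i t + (-1) ^+ b * i%:R = dip N j t + (-1) ^+ b * j%:R.
Proof.
move=> iN jN; have c0 := inv_sqrt1D_gt0 t; rewrite !support_body_dir// ?ltW//.
split=> [/mulfI-/(_ (lt0r_neq0 c0))|E]; first by lra.
by congr (_ * _); lra.
Qed.

(** In the direction (1, 0) all tents vanish, since they live over [t >= w]; what is left of the
    support function there determines the index. *)
Lemma body_inj i j : (0 < i <= N)%N -> (0 < j <= N)%N -> body i = body j -> i = j.
Proof.
have dip0 k : (0 < k)%N -> dip N k (0 : R) = 0.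
  move=> k0; apply/max_idPl; rewrite ge_min; apply/orP; left.
  have : w * 1 <= w * k%:R by rewrite ler_wpM2l// ler1n.
  by have := ler0n R N; lra.
move=> iN jN E; have := support_body_eq_dir false 0 iN jN; rewrite E => -[/(_ erefl) + _].
rewrite !dip0; [|by case/andP: jN|by case/andP: iN].
by rewrite expr0 !mul1r !add0r => /eqP; rewrite eqr_nat => /eqP.
Qed.

Lemma common_supporting_tangents_body i j : (0 < i)%N -> (i < j)%N -> (j <= N)%N ->
  let d : R := j%:R - i%:R in
  common_supporting_tangents (body i) (body j) =
  [set` [:: vec2 0 1; vec2 0 (-1);
      dir false (2 * (w * i%:R) - w + d); dir false (2 * (w * i%:R) + w - d);
      dir true (2 * (w * j%:R) - w + d); dir true (2 * (w * j%:R) + w - d)]].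
Proof.
move=> i0 ij jN d; have iN' : (0 < i <= N)%N by lia.
have jN' : (0 < j <= N)%N by lia.
have d0 : 0 < d by rewrite subr_gt0 ltr_nat.
have dw : d < w by rewrite /d -natrB ?ltr_nat; lia.
have ijN : i <> j by lia.
have crossing b t : support_function (body i) (dir b t) = support_function (body j) (dir b t) <->
    if b then t = 2 * (w * j%:R) - w + d \/ t = 2 * (w * j%:R) + w - d
    else t = 2 * (w * i%:R) - w + d \/ t = 2 * (w * i%:R) + w - d.
  have ji : j <> i by lia.
  have := dip_crossing t ijN d0 dw; have := dip_crossing t ji d0 dw.
  rewrite support_body_eq_dir// /d; case: b; rewrite ?expr1 ?expr0 => Dj Di.
    by rewrite -Dj; split; lra.
  by rewrite -Di; split; lra.
apply/seteqP; split=> theta /=.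
  case=> /unit_circle_cases[->|->|[b [t ->]]]; rewrite ?inE ?eqxx ?orbT//.
  by move/crossing; case: b => -[->|->]; rewrite ?eqxx /= ?orbT.
have U y : y ^+ 2 = 1 -> unit_circle (vec2 0 y : 'rV[R]_2).
  by move=> y1; rewrite /unit_circle/= dotprod_vec2 mul0r add0r -expr2.
rewrite ?inE ?orbF => /orP[/eqP->|/orP[/eqP->|/orP[/eqP->|/orP[/eqP->|/orP[]/eqP->]]]];
  split; rewrite ?support_body_up ?support_body_down//; try exact: unit_dir;
  try by (apply: U; rewrite ?expr1n ?sqrrN ?expr1n).
all: by apply/crossing; by [left|right].
Qed.

Lemma card_common_supporting_tangents_body i j : (0 < i)%N -> (i < j)%N -> (j <= N)%N ->
  (common_supporting_tangents (body i) (body j) #= `I_6)%card.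
Proof.
move=> i0 ij jN; rewrite common_supporting_tangents_body//.
have d0 : 0 < j%:R - i%:R :> R by rewrite subr_gt0 ltr_nat.
have dw : j%:R - i%:R < w by rewrite -natrB ?ltr_nat; lia.
apply: (card_eq_uniq (vec2 0 1)) => /=.
rewrite !inE !vertical_dir !dir_eq /= !orbF !andbT.
(* What remains is that the vertical directions differ and that the two crossings inside one tent
   differ; the latter is [dw]. *)
apply/and3P; split; apply/eqP; [move=> /vec2_inj[_]|..]; lra.
Qed.

(** The vertex of height [a] on side [b] is strictly separated from all other members. The direction
    is the middle of the tent of [a], where the height [k] falls short of the height [a] by
    [w (k - a)^2]. Members translated further inward lose by the translation; the body [a] lacks
    this height and loses at least [w], more than any translation can compensate. For [a = 0] or
    [a = N + 1] there is no such body. *)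
Lemma body_not_sub_hull (G : set (set 'rV[R]_2)) b m a :
  G `<=` bodies -> (0 < m <= N)%N -> (a <= N.+1)%N -> a <> m ->
  (forall l, (0 < l <= N)%N -> G (body l) -> l <> m ->
     (-1) ^+ b * m%:R < (-1) ^+ b * l%:R :> R \/ l = a) ->
  ~ (body m `<=` convex_hull (\bigcup_(L in G `\ body m) L)).
Proof.
move=> GF mN aN am Gl hull; have := hull _ (body_site R b aN am).
pose theta : 'rV[R]_2 := vec2 ((-1) ^+ b * 1) (1 * (2 * (w * a%:R))).
suff : convex_hull (\bigcup_(L in G `\ body m) L) `<=`
    [set p | dotprod theta p < dotprod theta (site b a m%:R)].
  by move=> /[apply]/=; rewrite ltxx.
apply: smallest_sub; first exact: convex_open_halfplane.
move=> p [L [GL Lm] Lp]; have [l lN E] := (bodiesP L).1 (GF _ GL); subst L.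
have lm : l <> m by move=> E; apply: Lm; rewrite E.
have {}Gl := Gl l lN GL lm; move: p Lp; apply: body_sub; first by case/andP: lN.
  exact: convex_open_halfplane.
move=> b' k kN kl /=.
apply: le_lt_trans (dotprod_site_le b b' l _ ler01 kN) _.
rewrite dotprod_site addbb expr0 /tooth.
have w0 : 0 <= w by [].
have sq0 : 0 <= w * (k%:R - a%:R) ^+ 2 by rewrite mulr_ge0// sqr_ge0.
case: Gl => [ml|la]; first by lra.
have sq1 : w <= w * (k%:R - a%:R) ^+ 2.
  have ka : k <> a by rewrite -la.
  rewrite ler_peMr//; case: (ltngtP k a) => [lt_ka|lt_ak|/ka//].
    have : k%:R + 1 <= a%:R :> R by rewrite natr1 ler_nat.
    by nra.
  have : a%:R + 1 <= k%:R :> R by rewrite natr1 ler_nat.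
  by nra.
(* Indices lie between 1 and [N], so they differ by at most [N - 1]. *)
have : (-1) ^+ b * (m%:R - l%:R) < w.
  have lN' : l%:R <= w by rewrite ler_nat; lia.
  have mN' : m%:R <= w by rewrite ler_nat; lia.
  have l1 : 1 <= l%:R :> R by rewrite ler1n; lia.
  have m1 : 1 <= m%:R :> R by rewrite ler1n; lia.
  by case: (b); rewrite ?expr1 ?expr0; lra.
move: sq1; rewrite la; lra.
Qed.

Lemma site_conv b k (l c r : R) : l < c -> c < r ->
  site b k c = ((r - c) / (r - l)) *: site b k l + (1 - (r - c) / (r - l)) *: site b k r.
Proof.
move=> lc cr; have rl : r - l != 0 by rewrite subr_eq0 gt_eqF//; lra.
by apply/rowP => e; rewrite !mxE; case: ifP => _; field.
Qed.

(** A height [k] is deleted only from the body [k], so at least one of [a], [b] and one of [d], [e]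
    keep it. The vertex of [c] at this height lies between theirs on a horizontal segment. *)
Lemma body_sub_hull (G : set (set 'rV[R]_2)) (a b c d e : nat) :
  (0 < a)%N -> (a < b)%N -> (b < c)%N -> (c < d)%N -> (d < e)%N -> (e <= N)%N ->
  G (body a) -> G (body b) -> G (body d) -> G (body e) ->
  body c `<=` convex_hull (\bigcup_(L in G `\ body c) L).
Proof.
move=> a0 ab bc cd de eN Ga Gb Gd Ge.
apply: body_sub => [|A /= [cA subA]|s k kN kc A /= [cA subA]]; first by lia.
  exact: convex_convex_hull.
have inA l : (0 < l <= N)%N -> l <> c -> l <> k -> G (body l) -> A (site s k l%:R).
  move=> lN lc lk Gl; apply: subA; exists (body l); last by apply: body_site => //; exact/nesym.
  by split=> // /body_inj E; apply: lc; apply: E => //; lia.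
have [l [lc Al]] : exists l, (l < c)%N /\ A (site s k l%:R).
  have [ka|ka] := eqVneq a k.
    by exists b; split=> //; apply: inA => //; lia.
  by exists a; split; [lia|apply: inA => //; [lia|lia|exact/eqP]].
have [r [cr Ar]] : exists r, (c < r)%N /\ A (site s k r%:R).
  have [kd|kd] := eqVneq d k.
    by exists e; split; [lia|apply: inA => //; lia].
  by exists d; split; [lia|apply: inA => //; [lia|lia|exact/eqP]].
have lcR : l%:R < c%:R :> R by rewrite ltr_nat.
have crR : c%:R < r%:R :> R by rewrite ltr_nat.
rewrite (site_conv s k lcR crR); move/convex_setP: cA; apply=> //.
  by rewrite divr_ge0//; lra.
by rewrite ler_pdivrMr; lra.
Qed.

(** Turns a subfamily of given cardinality into the increasing list of its indices, so that members
    can be addressed by rank. *)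
Lemma bodies_indices (G : set (set 'rV[R]_2)) n : G `<=` bodies -> (G #= `I_n)%card ->
  exists s : seq nat, [/\ sorted ltn s, size s = n, {in s, forall i, (0 < i <= N)%N /\ G (body i)}
    & forall i, (0 < i <= N)%N -> G (body i) -> i \in s].
Proof.
move=> GF Gn; pose s := [seq i <- iota 1 N | `[< G (body i) >]].
have sP i : (i \in s) = `[< G (body i) >] && (0 < i <= N)%N.
  by rewrite mem_filter mem_iota add1n ltnS.
exists s; split=> [||i|i iN Gi].
- by apply: sorted_filter; [exact: ltn_trans|exact: iota_ltn_sorted].
- apply/card_eq_II; apply: card_eq_trans Gn.
  apply: card_esym; apply: card_eq_trans (card_eq_uniq 0%N _); last first.
    by rewrite filter_uniq// iota_uniq.
  have -> : G = body @` [set` s].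
    apply/seteqP; split=> [K GK|_ [i /= + <-]].
      have [i iN E] := (bodiesP K).1 (GF _ GK); exists i => //=.
      by rewrite sP iN andbT; apply/asboolP; rewrite -E.
    by rewrite sP => /andP[/asboolP].
  apply: inj_card_eq => i j /set_mem /=; rewrite sP => /andP[_ iN].
  by move=> /set_mem /=; rewrite sP => /andP[_ jN]; exact: body_inj.
- by rewrite sP => /andP[/asboolP].
- by rewrite sP iN andbT; apply/asboolP.
Qed.

Lemma four_bodies (G : set (set 'rV[R]_2)) : G `<=` bodies -> (G #= `I_4)%card ->
  in_convex_position G.
Proof.
move=> GF G4 K GK; have [m mN E] := (bodiesP K).1 (GF _ GK); subst K.
have [s [ss s4 sG Gs]] := bodies_indices GF G4.
case: s s4 ss sG Gs => [//|p [//|q [//|u [//|v [|//]]]]] _ /= /and4P[pq qu uv _] sG Gs.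
have pG := (sG p); have qG := (sG q); have uG := sG u; have vG := sG v.
move: pG qG uG vG; rewrite !inE !eqxx ?orbT => /(_ erefl)[pN pG] /(_ erefl)[qN qG]
  /(_ erefl)[uN uG] /(_ erefl)[vN vG].
have : m \in [:: p; q; u; v] by exact: Gs.
have low a : (a < m)%N -> (forall l, l \in [:: p; q; u; v] -> l <> m -> (m < l)%N \/ l = a) ->
    ~ (body m `<=` convex_hull (\bigcup_(L in G `\ body m) L)).
  move=> am H; apply: (@body_not_sub_hull G false m a) => //; [lia|lia|].
  move=> l lN Gl lm; have [|->] := H l (Gs l lN Gl) lm; last by right.
  by left; rewrite expr0 !mul1r ltr_nat.
have high a : (m < a)%N -> (a <= N.+1)%N ->
    (forall l, l \in [:: p; q; u; v] -> l <> m -> (l < m)%N \/ l = a) ->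
    ~ (body m `<=` convex_hull (\bigcup_(L in G `\ body m) L)).
  move=> ma aN H; apply: (@body_not_sub_hull G true m a) => //; [lia|].
  move=> l lN Gl lm; have [|->] := H l (Gs l lN Gl) lm; last by right.
  by left; rewrite expr1 !mulN1r ltrN2 ltr_nat.
rewrite !inE => /or4P[]/eqP E; subst m.
(* By rank: the extreme indices are exposed at a height that no body lacks, 0 or [N + 1]; the second
   and the third are exposed at the height deleted from their outer neighbour, [p] on the right side
   and [v] on the left. *)
- by apply: (low 0%N) => [|l]; rewrite ?inE; lia.
- by apply: (low p) => [|l]; rewrite ?inE; lia.
- by apply: (high v) => [||l]; rewrite ?inE; lia.
- by apply: (high N.+1) => [||l]; rewrite ?inE; lia.
Qed.

Lemma five_bodies (G : set (set 'rV[R]_2)) : G `<=` bodies -> (G #= `I_5)%card ->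
  ~ in_convex_position G.
Proof.
move=> GF G5 pos; have [s [ss s5 sG _]] := bodies_indices GF G5.
case: s s5 ss sG => [//|a [//|b [//|c [//|d [//|e [|//]]]]]] _ /=.
move=> /and5P[ab bc cd de _] sG.
have [aN Ga] : (0 < a <= N)%N /\ G (body a) by apply: sG; rewrite !inE eqxx ?orbT.
have [_ Gb] : (0 < b <= N)%N /\ G (body b) by apply: sG; rewrite !inE eqxx ?orbT.
have [_ Gc] : (0 < c <= N)%N /\ G (body c) by apply: sG; rewrite !inE eqxx ?orbT.
have [_ Gd] : (0 < d <= N)%N /\ G (body d) by apply: sG; rewrite !inE eqxx ?orbT.
have [eN Ge] : (0 < e <= N)%N /\ G (body e) by apply: sG; rewrite !inE eqxx ?orbT.
(* The middle index has two members on either side. *)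
by apply: (pos _ Gc); apply: body_sub_hull Ga Gb Gd Ge => //; lia.
Qed.

End Family.

Theorem mainTheorem4 (R : realType) (N : nat) :
  exists F : set (set 'rV[R]_2),
    [/\ finite_set F /\ (`I_N #<= F)%card,
        forall K, F K -> convex_body K,
        forall K L, F K -> F L -> K <> L ->
          (common_supporting_tangents K L #= `I_6)%card,
        forall G : set (set 'rV[R]_2), G `<=` F -> (G #= `I_4)%card ->
          in_convex_position G
      & forall G : set (set 'rV[R]_2), G `<=` F -> (G #= `I_5)%card ->
          ~ in_convex_position G].
Proof.
exists (@bodies R N); split.
- split; first exact/finite_image/finite_II.
  have : (@bodies R N #= `I_N)%card.
    by apply: inj_card_eq => i j /set_mem iN /set_mem jN /body_inj-/(_ iN jN)[].
  by rewrite card_eq_le => /andP[].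
- by move=> K /bodiesP[i _ ->]; exact: convex_body_body.
- move=> K L /bodiesP[i /andP[i0 iN] ->] /bodiesP[j /andP[j0 jN] ->] KL.
  have sym A B : common_supporting_tangents A B = common_supporting_tangents B A :> set 'rV[R]_2.
    by apply/seteqP; split=> theta [].
  case: (ltngtP i j) => [ij|ji|E]; last by rewrite E in KL.
    exact: card_common_supporting_tangents_body.
  by rewrite sym; exact: card_common_supporting_tangents_body.
- exact: four_bodies.
- exact: five_bodies.
Qed.
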